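(* Let $K$ be a valued field with surjective valuation $v:K\to\mathbb{R}_{\max}$, let $V$ be a vector space over $K$, let $E\subseteq V$ be a finite subset, and let $M$ be the linear valuated matroid induced by $E$. Given an $\mathcal{O}_K$-submodule $N\subseteq V$, let $$F_N = \{ v(c) x \mid x\in E,\ c\in K,\ cx\in N\}\subseteq \hat M .$$ Then the following hold. (1) $F\subseteq \hat{M}$ is a flat if and only if $F = F_N$ for some $\mathcal{O}_K$-submodule $N\subseteq V$. (2) If $F\subseteq \hat{M}$ is a flat, there is exactly one finitely generated $\mathcal{O}_K$-submodule $N\subseteq V$ such that $N$ is generated by elements which have the form $ax$ for $a\in K$ and $x\in E$ and such that $F = F_N$. In particular, flats of $M$ are in one-to-one correspondence with $\mathcal{O}_K$-submodules of $V$ which are generated by elements of this form.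
   Context: $\mathbb{R}_{\max}=\mathbb{R}\cup\{-\infty\}$ with addition $\max$ and multiplication the usual addition of reals, written multiplicatively; its multiplicative unit (the real number $0$) is written $1$. A valuation is written multiplicatively: $v:K\to\mathbb{R}_{\max}$ with $v(ab)=v(a)v(b)$, $v(a+b)\le\max(v(a),v(b))$, and $v(a)=-\infty$ iff $a=0$. $\mathcal{O}_K=\{a\in K\mid v(a)\le 1\}$. $\hat M$ is $\mathbb{R}_{\max}\times E$ with $\{-\infty\}\times E$ collapsed to one point $\mathbf 0$; the class of $(a,x)$ is written $ax$. Partial order on $\hat M$: $ax\le by$ iff either both are $\mathbf 0$, or $x=y$ and $a\le b$ (so $\mathbf 0=(-\infty)x\le bx$). Linear valuated matroid $M$ induced by $E$: its circuit sets are the subsets $\{a_1x_1,\dots,a_nx_n\}\subseteq\hat M$ with $x_1,\dots,x_n\in E$ distinct such that there is a linear relation $\sum_i\alpha_ix_i=0$ in $V$ with $\alpha_i\in K\setminus\{0\}$, $v(\alpha_i)=a_i$, of minimal support (i.e. $\{x_1,\dots,x_n\}$ is a minimal linearly dependent subset of $E$). A flat is a nonempty subset $F\subseteq\hat M$ that is downward closed and such that for every circuit set $C$ and $u\in C$, if $C\setminus\{u\}\subseteq F$ then $u\in F$.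
   Formalization: E is assumed nonempty (else F_N is empty, not a flat). In (2), ''finitely generated'' is dropped for general flats (false for V=K, E={1}, F=M̂, which forces N=K); with it, (2) is stated for flats that are the smallest flat containing some finite set. *)

(* Defs.v *)
From HB Require Import structures.
From mathcomp Require Import all_boot all_order all_algebra finmap.
From mathcomp Require Import boolp classical_sets functions cardinality.
From mathcomp Require Import reals constructive_ereal.

Set Implicit Arguments.
Unset Strict Implicit.
Unset Printing Implicit Defensive.

Import Order.TTheory GRing.Theory Num.Theory.
Local Open Scope classical_set_scope.
Local Open Scope ring_scope.

(** R_max is the set of extended reals other than +oo. *)

Record Rmax (R : realType) := MkRmax {
  rmax_val : \bar R;
  rmax_valP : rmax_val != +oo%E }.

HB.instance Definition _ (R : realType) := [isSub for @rmax_val R].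
HB.instance Definition _ (R : realType) := [Choice of Rmax R by <:].
HB.instance Definition _ (R : realType) :=
  [SubChoice_isSubOrder of Rmax R by <: with ereal_display].

Fact rmax_mul_subproof (R : realType) (a b : Rmax R) :
  (rmax_val a + rmax_val b)%E != +oo%E.
Proof. by case: a b => [[x| |] ?] [[y| |] ?]. Qed.

Definition rmax_mul (R : realType) (a b : Rmax R) : Rmax R :=
  MkRmax (rmax_mul_subproof a b).

Definition rmax_fin (R : realType) (r : R) : Rmax R :=
  @MkRmax R r%:E isT.

Definition rmax_bot (R : realType) : Rmax R := @MkRmax R -oo%E isT.

(** The multiplicative unit of R_max is the real number 0. *)
Definition rmax_one (R : realType) : Rmax R := rmax_fin 0.

Record is_valuation (R : realType) (K : fieldType) (v : K -> Rmax R) : Prop :=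
  IsValuation {
    valuationM : forall a b, v (a * b) = rmax_mul (v a) (v b);
    valuationD : forall a b, (v (a + b) <= Order.max (v a) (v b))%O;
    valuation_eq_bot : forall a, v a = rmax_bot R <-> a = 0 }.

Definition valuation_ring (R : realType) (K : fieldType) (v : K -> Rmax R) :
  set K := [set a | (v a <= rmax_one R)%O].

Section Submodules.
Variables (R : realType) (K : fieldType) (v : K -> Rmax R) (V : lmodType K).

(** Closure under opposite follows, since -1 lies in the valuation ring. *)
Definition is_submodule (N : set V) : Prop :=
  [/\ N 0,
      (forall x y, N x -> N y -> N (x + y)) &
      (forall a x, valuation_ring v a -> N x -> N (a *: x))].

Definition generated_by (N S : set V) : Prop := N = smallest is_submodule S.

Definition fin_generated (N : set V) : Prop :=
  exists2 S : set V, finite_set S & generated_by N S.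

Definition E_multiples (E : {fset V}) : set V :=
  [set y | exists (a : K) (x : E), y = a *: val x].

Definition generated_by_multiples (E : {fset V}) (N : set V) : Prop :=
  exists2 S : set V, S `<=` E_multiples E & generated_by N S.

End Submodules.

(** [None] is the point to which {-oo} x E is collapsed; [Some (r, x)] is the
    class of (r, x) for r a real number. *)
Definition Mhat (R : realType) (T : Type) : Type := option (R * T).

Definition mzero {R : realType} {T : Type} : Mhat R T := None.

(** The class, in [Mhat R T], of a pair of [Rmax R * T]. *)
Definition mcls (R : realType) (T : Type) (a : Rmax R) (x : T) : Mhat R T :=
  if rmax_val a is r%:E then Some (r, x) else mzero.

Definition mle (R : realType) (T : Type) (u w : Mhat R T) : Prop :=
  (u = mzero /\ w = mzero) \/
  (exists (a b : Rmax R) (x y : T),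
     [/\ u = mcls a x, w = mcls b y, x = y & (a <= b)%O]).

Section LinearValuatedMatroid.
Variables (R : realType) (K : fieldType) (v : K -> Rmax R) (V : lmodType K).
Variable E : {fset V}.

Definition lin_dependent (A : {set E}) : Prop :=
  exists2 beta : E -> K,
    (exists2 x, x \in A & beta x != 0) & \sum_(x in A) beta x *: val x = 0.

Definition min_lin_dependent (A : {set E}) : Prop :=
  lin_dependent A /\ forall B : {set E}, B \proper A -> ~ lin_dependent B.

Definition is_circuit (C : set (Mhat R E)) : Prop :=
  exists (A : {set E}) (alpha : E -> K),
    [/\ min_lin_dependent A,
        forall x, x \in A -> alpha x != 0,
        \sum_(x in A) alpha x *: val x = 0 &
        C = [set mcls (v (alpha x)) x | x in [set` A]]].

Definition is_flat (F : set (Mhat R E)) : Prop :=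
  [/\ F !=set0,
      forall u w, mle u w -> F w -> F u &
      forall C u, is_circuit C -> C u -> C `\ u `<=` F -> F u].

Definition fin_generated_flat (F : set (Mhat R E)) : Prop :=
  exists2 S : set (Mhat R E), finite_set S & F = smallest is_flat S.

Definition flat_of (N : set V) : set (Mhat R E) :=
  [set u | exists (x : E) (c : K), N (c *: val x) /\ u = mcls (v c) x].

End LinearValuatedMatroid.

Arguments flat_of {R K} v {V} E N u.

(* Main.v *)
(** A flat F corresponds to the module N_F of all sums of a_y y, y in E, with
    every v(a_y) y in F.  That no new multiple v(c) x arises in this module is
    an elimination argument: given a relation among the vectors of E all of
    whose terms but the one at x lie in F, choose a circuit inside its support
    and scale it so that it agrees with the relation at one element and is
    dominated by it everywhere else.  The circuit axiom handles the circuit,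
    and subtracting it shrinks the support of the relation. *)

Require Import Defs.
From mathcomp Require Import all_boot all_order all_algebra finmap.
From mathcomp Require Import boolp classical_sets functions cardinality reals.
From mathcomp Require Import constructive_ereal ring.

Local Open Scope classical_set_scope.
Local Open Scope ring_scope.

Set Implicit Arguments.
Unset Strict Implicit.
Unset Printing Implicit Defensive.

Import Order.TTheory GRing.Theory Num.Theory.

(** * Order and multiplication in [Rmax] *)

Section Rmax.
Variable R : realType.
Implicit Types a b c : Rmax R.

Lemma rmax_leE a b : (a <= b)%O = (rmax_val a <= rmax_val b)%E.
Proof. by []. Qed.

Lemma rmax_bot_le a : (rmax_bot R <= a)%O.
Proof. by rewrite rmax_leE leNye. Qed.

Lemma rmax_le_bot a : (a <= rmax_bot R)%O -> a = rmax_bot R.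
Proof. by move=> h; apply: le_anti; rewrite h rmax_bot_le. Qed.

Lemma rmax_le_mul2l a b c :
  (a <= b)%O -> (rmax_mul c a <= rmax_mul c b)%O.
Proof. by rewrite !rmax_leE /= => h; exact: leeD2l. Qed.

Lemma rmax_mulC a b : rmax_mul a b = rmax_mul b a.
Proof. by apply: val_inj; rewrite /= addeC. Qed.

Lemma rmax_mul1l a : rmax_mul (rmax_one R) a = a.
Proof. by apply: val_inj; rewrite /= add0e. Qed.

Lemma rmax_neq_bot a : a != rmax_bot R -> exists r, a = rmax_fin r.
Proof.
case: a => [[r| |] rP] a0; first by exists r; apply: val_inj.
  by case/eqP: (rP).
by exfalso; move/eqP: a0; apply; apply: val_inj.
Qed.

Lemma rmax_mul_le_cancel a b : b != rmax_bot R ->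
  (rmax_mul a b <= b)%O -> (a <= rmax_one R)%O.
Proof.
move=> /rmax_neq_bot[y ->]; have [->|] := eqVneq a (rmax_bot R).
  by rewrite rmax_bot_le.
by move=> /rmax_neq_bot[x ->]; rewrite !rmax_leE /= !lee_fin gerDr.
Qed.

Lemma rmax_mul_idem a : a != rmax_bot R -> rmax_mul a a = a -> a = rmax_one R.
Proof.
move=> /rmax_neq_bot[x ->] /(congr1 (@rmax_val R)) [xx].
by congr rmax_fin; apply: (addrI x); rewrite xx addr0.
Qed.

Lemma rmax_square_one a : rmax_mul a a = rmax_one R -> a = rmax_one R.
Proof.
have [->|/rmax_neq_bot[x ->]] := eqVneq a (rmax_bot R).
  by move/(congr1 (@rmax_val R)).
move/(congr1 (@rmax_val R)) => [] /eqP.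
by rewrite -mulr2n mulrn_eq0 => /eqP ->.
Qed.

Lemma mcls_bot (T : Type) (x : T) : mcls (rmax_bot R) x = mzero.
Proof. by []. Qed.

Lemma mcls_inj (T : Type) a b (x y : T) : a != rmax_bot R ->
  mcls a x = mcls b y -> a = b /\ x = y.
Proof.
move=> /rmax_neq_bot[r ->]; have [->//|/rmax_neq_bot[s ->]] := eqVneq b (rmax_bot R).
by move=> [-> ->].
Qed.

End Rmax.

(** * Valuations of units, opposites and quotients *)

Section Valuation.
Variables (R : realType) (K : fieldType) (v : K -> Rmax R).
Hypothesis vP : is_valuation v.

Lemma valuation0 : v 0 = rmax_bot R.
Proof. exact/(valuation_eq_bot vP). Qed.

Lemma valuation_neq_bot a : a != 0 -> v a != rmax_bot R.
Proof. by apply: contra_neq => /(valuation_eq_bot vP). Qed.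

Lemma valuation1 : v 1 = rmax_one R.
Proof.
apply: rmax_mul_idem; first exact/valuation_neq_bot/oner_neq0.
by rewrite -(valuationM vP) mulr1.
Qed.

(** The square of -1 is 1 and the reals have no 2-torsion, so [v (-1)] is the unit. *)
Lemma valuationN a : v (- a) = v a.
Proof.
rewrite -mulN1r (valuationM vP) (_ : v (-1) = rmax_one R) ?rmax_mul1l//.
by apply: rmax_square_one; rewrite -(valuationM vP) mulN1r opprK valuation1.
Qed.

Lemma valuation_ring_mul_le c a : valuation_ring v c -> (v (c * a) <= v a)%O.
Proof.
move=> hc; rewrite (valuationM vP) rmax_mulC -[leRHS]rmax_mul1l [leRHS]rmax_mulC.
exact: rmax_le_mul2l.
Qed.

Lemma valuation_ring_div a b :
  b != 0 -> (v a <= v b)%O -> valuation_ring v (a / b).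
Proof.
move=> b0 ab; apply: (@rmax_mul_le_cancel _ _ (v b)).
  exact: valuation_neq_bot.
by rewrite -(valuationM vP) divfK.
Qed.

Lemma valuation_ringN1 : valuation_ring v (-1).
Proof. by rewrite /valuation_ring /= valuationN valuation1. Qed.

End Valuation.

(** * Submodules over the valuation ring *)

Section Submodules.
Variables (R : realType) (K : fieldType) (v : K -> Rmax R) (V : lmodType K).
Hypothesis vP : is_valuation v.
Implicit Types N S : set V.

Lemma submodule_sum N (I : finType) (P : pred I) (f : I -> V) :
  is_submodule v N -> (forall i, P i -> N (f i)) -> N (\sum_(i | P i) f i).
Proof. by move=> [N0 ND _] hf; elim/big_ind : _. Qed.

Lemma submoduleN N x : is_submodule v N -> N x -> N (- x).
Proof.
by move=> [_ _ NZ] Nx; rewrite -scaleN1r; apply: NZ => //; exact: valuation_ringN1.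
Qed.

Lemma submodule_le N a b (x : V) : is_submodule v N ->
  (v a <= v b)%O -> N (b *: x) -> N (a *: x).
Proof.
(* For nonzero [b] the factor [a / b] is integral; for [b = 0] the bound forces [a = 0]. *)
move=> [N0 _ NZ] ab Nb; have [b0|b0] := eqVneq b 0.
  move: ab; rewrite b0 (valuation0 vP) => /rmax_le_bot /(valuation_eq_bot vP) ->.
  by rewrite scale0r.
by rewrite -(divfK b0 a) -scalerA; apply: NZ => //; exact: valuation_ring_div.
Qed.

Lemma smallest_submodule S : is_submodule v (smallest (is_submodule v (V := V)) S).
Proof.
split.
- by move=> N [[]].
- move=> x y hx hy N NS; have [[_ ND _] _] := NS.
  by apply: ND; [exact: hx|exact: hy].
- by move=> a x va hx N NS; have [[_ _ NZ] _] := NS; apply: NZ => //; exact: hx.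
Qed.

End Submodules.

(** * Flats from submodules, elimination in flats, and submodules from flats *)

Section Flats.
Variables (R : realType) (K : fieldType) (v : K -> Rmax R).
Hypothesis vP : is_valuation v.
Hypothesis v_surj : forall r : Rmax R, exists a : K, v a = r.
Variables (V : lmodType K) (E : {fset V}).
Hypothesis E_neq0 : E != fset0.
Implicit Types (N S : set V) (F : set (Mhat R E)) (x y : E).

(** Scalars of equal valuation differ by a unit of the valuation ring, so the choice of
    representative is harmless. When [c = 0] the class forgets [x], but then the vector is 0. *)
Lemma flat_ofP N x c : is_submodule v N ->
  flat_of v E N (mcls (v c) x) <-> N (c *: val x).
Proof.
move=> NP; split=> [[y [d [Nd]]]|Nc]; last by exists x, c.
have [->|c0] := eqVneq c 0; first by rewrite scale0r; case: NP.
move/(mcls_inj (valuation_neq_bot vP c0)) => [cd ->].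
by apply: (submodule_le vP NP _ Nd); rewrite cd.
Qed.

Lemma flat_of_mzero N : is_submodule v N -> flat_of v E N mzero.
Proof.
move=> [N0 _ _]; have /fset0Pn[x xE] := E_neq0.
by exists [` xE]%fset, 0; rewrite scale0r (valuation0 vP) mcls_bot.
Qed.

Lemma flat_of_flat N : is_submodule v N -> is_flat v (flat_of v E N).
Proof.
move=> NP; have F0 := flat_of_mzero NP.
split; first by exists mzero.
- move=> u w [[-> _]//|[a [b [x [_ [-> -> <- ab]]]]]].
  case: (v_surj a) (v_surj b) => a' ? [b' ?]; subst a b.
  move/(flat_ofP _ _ NP) => Nb; apply/(flat_ofP _ _ NP).
  exact: (submodule_le vP NP ab).
- move=> C u [A [alpha [_ alpha0 rel ->]]] [x /= xA <-] hC.
  (* Solve the circuit relation for the term at [x]; all other terms lie in [N]. *)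
  apply/(flat_ofP _ _ NP); move: rel; rewrite (bigD1 x)//=.
  move/eqP; rewrite addr_eq0 => /eqP ->.
  apply: (submoduleN vP NP); apply: (submodule_sum NP) => y /andP[yA yx].
  apply/(flat_ofP _ _ NP); apply: hC; split; first by exists y.
  (* Nonzero coefficients keep the classes at distinct vectors distinct. *)
  move/(mcls_inj (valuation_neq_bot vP (alpha0 _ yA))) => [_ yx'].
  by rewrite yx' eqxx in yx.
Qed.

Lemma mzero_le (u : Mhat R E) : mle mzero u.
Proof.
case: u => [[r x]|]; last by left.
by right; exists (rmax_bot R), (rmax_fin r), x, x; split=> //; exact: rmax_bot_le.
Qed.

Lemma flat_mzero F : is_flat v F -> F mzero.
Proof. by move=> [[u Fu] Fle _]; exact: Fle (mzero_le u) Fu. Qed.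

Lemma flat_le F a b x : is_flat v F ->
  (a <= b)%O -> F (mcls b x) -> F (mcls a x).
Proof. by move=> [_ Fle _] ab; apply: Fle; right; exists a, b, x, x. Qed.

Lemma flatD F a b x : is_flat v F ->
  F (mcls (v a) x) -> F (mcls (v b) x) -> F (mcls (v (a + b)) x).
Proof.
move=> FP Fa Fb; apply: (flat_le FP (valuationD vP a b)).
by case: (leP (v a) (v b)).
Qed.

Lemma lin_dependent_min (A : {set E}) : lin_dependent A ->
  exists2 B : {set E}, B \subset A & min_lin_dependent B.
Proof.
have [n] := ubnP #|A|; elim: n A => // n IH A; rewrite ltnS => An Adep.
have [[B [BA Bdep]]|noB] :=
  pselect (exists B : {set E}, B \proper A /\ lin_dependent B).
  have [C CB Cmin] := IH B (leq_trans (proper_card BA) An) Bdep.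
  by exists C => //; exact: fintype.subset_trans CB (proper_sub BA).
by exists A => //; split=> // B BA Bdep; apply: noB; exists B.
Qed.

(** A vanishing coefficient at [x] would leave a dependence on the proper subset without [x]. *)
Lemma min_lin_dependent_neq0 (A : {set E}) (g : E -> K) x :
  min_lin_dependent A ->
  \sum_(y in A) g y *: val y = 0 -> (exists2 y, y \in A & g y != 0) ->
  x \in A -> g x != 0.
Proof.
move=> [_ Amin] rel [y yA gy] xA; apply/eqP => gx.
apply: (Amin (A :\ x)%SET (properD1 xA)); exists g.
  by exists y => //; rewrite !inE yA andbT; apply: contra_neq gy => ->.
by move: rel; rewrite (big_setD1 x)//= gx scale0r add0r.
Qed.

Lemma flat_circuit F (A : {set E}) (g : E -> K) x : is_flat v F ->
  min_lin_dependent A -> (forall y, y \in A -> g y != 0) ->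
  \sum_(y in A) g y *: val y = 0 -> x \in A ->
  (forall y, y \in A -> y != x -> F (mcls (v (g y)) y)) -> F (mcls (v (g x)) x).
Proof.
move=> [_ _ Fcirc] Amin g0 rel xA hF.
apply: (Fcirc [set mcls (v (g y)) y | y in [set` A]]).
- by exists A, g.
- by exists x.
- by move=> _ [[y /= yA <-] yx]; apply: hF => //; apply: contra_notN yx => /eqP ->.
Qed.

Lemma flat_relation F (b : E -> K) x : is_flat v F ->
  \sum_y b y *: val y = 0 ->
  (forall y, y != x -> F (mcls (v (b y)) y)) -> F (mcls (v (b x)) x).
Proof.
(* Induction on the size of the support of the relation. *)
move=> FP; have [n] := ubnP #|[set y | b y != 0]%SET|.
elim: n b => // n IH b; rewrite ltnS => bn rel hF.
have [->|bx0] := eqVneq (b x) 0.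
  by rewrite (valuation0 vP); exact: flat_mzero.
set B := [set y | b y != 0]%SET in bn.
have Bdep : lin_dependent B.
  exists b; first by exists x; rewrite ?inE.
  rewrite -[RHS]rel [RHS](bigID (mem B))/= [X in _ = _ + X]big1 ?addr0// => y.
  by rewrite inE negbK => /eqP ->; rewrite scale0r.
have [A AB Amin] := lin_dependent_min Bdep.
have [[g g_neq0 grel] _] := Amin.
have g0 y : y \in A -> g y != 0 by exact: min_lin_dependent_neq0.
have b0 y : y \in A -> b y != 0 by move/(fintype.subsetP AB); rewrite inE.
have [z zA _] := g_neq0.
(* The pivot [y0] maximises the valuation of [g y / b y]. Scaling [g] to meet [b] at [y0] gives [h],
   and maximality yields [v (h y) <= v (b y)] everywhere. *)
case: (@Order.TotalTheory.arg_maxP _ _ _ z (mem A)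
         (fun y => v (g y / b y)) zA) => y0 y0A y0max.
pose h y := if y \in A then b y0 / g y0 * g y else 0.
have hA y : y \in A -> h y = b y0 / g y0 * g y by rewrite /h => ->.
have hNA y : y \notin A -> h y = 0 by rewrite /h => /negbTE ->.
have hrelA : \sum_(y in A) h y *: val y = 0.
  transitivity ((b y0 / g y0) *: \sum_(y in A) g y *: val y).
    by rewrite scaler_sumr; apply: eq_bigr => y yA; rewrite hA// scalerA.
  by rewrite grel scaler0.
have hrel : \sum_y h y *: val y = 0.
  rewrite (bigID (mem A))/= hrelA add0r big1// => y yA.
  by rewrite hNA// scale0r.
have h_le y : (v (h y) <= v (b y))%O.
  have [yA|yA] := boolP (y \in A); last first.
    by rewrite hNA// (valuation0 vP) rmax_bot_le.
  (* With this common factor, comparing [h y] and [b y] becomes comparing the ratios at [y] and at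
     [y0]. *)
  pose c := b y0 * b y / g y0.
  have hE : h y = c * (g y / b y) by rewrite hA// /c; field; rewrite g0// b0.
  have bE : b y = c * (g y0 / b y0) by rewrite /c; field; rewrite g0// b0.
  by rewrite hE [in leRHS]bE !(valuationM vP c); apply: rmax_le_mul2l; exact: y0max.
have Fh : F (mcls (v (h x)) x).
  have [xA|xA] := boolP (x \in A); last first.
    by rewrite hNA// (valuation0 vP); exact: flat_mzero.
  apply: (flat_circuit FP Amin _ hrelA xA) => [y yA|y _ yx].
    by rewrite hA// mulf_neq0 ?g0// mulf_neq0 ?b0// invr_neq0 ?g0.
  exact: (flat_le FP (h_le y) (hF _ yx)).
(* Split [b x] as [(b x - h x) + h x]. The relation [b - h] has smaller support, since it vanishes
   at [y0]. *)
rewrite -(subrK (h x) (b x)); apply: flatD => //.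
apply: (IH (fun y => b y - h y)).
- apply: leq_trans bn; apply/proper_card/properP; split.
    apply/fintype.subsetP => y; rewrite !inE; apply: contra_neq => by0.
    have [yA|yA] := boolP (y \in A); first by have := b0 _ yA; rewrite by0 eqxx.
    by rewrite by0 hNA// subrr.
  exists y0; first exact: (fintype.subsetP AB).
  by rewrite inE hA// divfK ?g0// subrr eqxx.
- by under eq_bigr do rewrite scalerBl; rewrite sumrB rel hrel subr0.
- move=> y yx; apply: flatD => //; first exact: hF.
  by rewrite (valuationN vP); exact: (flat_le FP (h_le y) (hF _ yx)).
Qed.

Definition flat_multiples F : set V :=
  [set z | exists (a : K) x, F (mcls (v a) x) /\ z = a *: val x].

Definition flat_module F : set V := smallest (is_submodule v (V := V)) (flat_multiples F).

(** Sums with coefficients allowed by [F] already form a submodule containing the generators: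
    [flatD] and [flat_le] act one coefficient at a time. *)
Lemma flat_moduleP F z : is_flat v F -> flat_module F z ->
  exists2 a : E -> K,
    (forall y, F (mcls (v (a y)) y)) & z = \sum_y a y *: val y.
Proof.
move=> FP Nz.
apply: (Nz [set z | exists2 a : E -> K,
  (forall y, F (mcls (v (a y)) y)) & z = \sum_y a y *: val y]).
split; last first.
  move=> _ [a [x [Fa ->]]]; exists (fun y => if y == x then a else 0).
    move=> y; case: eqP => [->//|_].
    by rewrite (valuation0 vP); exact: flat_mzero.
  rewrite (bigD1 x)//= eqxx big1 ?addr0// => y /negbTE ->.
  by rewrite scale0r.
split.
- exists (fun=> 0); first by move=> y; rewrite (valuation0 vP); exact: flat_mzero.
  by rewrite big1// => y _; rewrite scale0r.
- move=> _ _ [a Fa ->] [b Fb ->]; exists (fun y => a y + b y).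
    by move=> y; exact: flatD.
  by rewrite -big_split; apply: eq_bigr => y _; rewrite scalerDl.
- move=> c _ vc [a Fa ->]; exists (fun y => c * a y).
    by move=> y; apply: (flat_le FP _ (Fa y)); exact: valuation_ring_mul_le.
  by rewrite scaler_sumr; apply: eq_bigr => y _; rewrite scalerA.
Qed.

Lemma flat_module_submodule F : is_submodule v (flat_module F).
Proof. exact: smallest_submodule. Qed.

Lemma flat_module_generated F : generated_by_multiples v E (flat_module F).
Proof. by exists (flat_multiples F) => // _ [a [x [_ ->]]]; exists a, x. Qed.

Lemma flat_of_flat_module F : is_flat v F -> flat_of v E (flat_module F) = F.
Proof.
move=> FP; apply/seteqP; split=> u.
  move=> [x [c [Nc ->]]]; have [a Fa ca] := flat_moduleP FP Nc.
  rewrite -(subrK (a x) c); apply: (flatD FP) => //.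
  (* These are the coefficients of the relation obtained by moving the sum to the side of
     [c *: val x]; elimination then puts the class of [c - a x] in [F]. *)
  pose b y := if y == x then c - a x else - a y.
  have -> : c - a x = b x by rewrite /b eqxx.
  apply: (flat_relation FP) => [|y yx]; last by rewrite /b (negbTE yx) (valuationN vP).
  rewrite (bigD1 x)//= {1}/b eqxx scalerBl ca (bigD1 x)//= [X in X + _]addrAC subrr add0r.
  rewrite -big_split big1// => y yx.
  by rewrite /b (negbTE yx) scaleNr /= subrr.
case: u => [[r x]|] Fu.
  have [a va] := v_surj (rmax_fin r).
  exists x, a; split; last by rewrite va.
  by apply: sub_gen_smallest; exists a, x; rewrite va.
exact: flat_of_mzero (flat_module_submodule F).
Qed.

(** This gives uniqueness: the flat of [N] records exactly which multiples of vectors of [E] lie in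
    [N], and those generate [N]. *)
Lemma flat_module_of_flat N : is_submodule v N -> generated_by_multiples v E N ->
  flat_module (flat_of v E N) = N.
Proof.
move=> NP [S SE NS]; apply/seteqP; split.
  apply: smallest_sub => // _ [a [x [Fa ->]]]; exact/(flat_ofP _ _ NP).
rewrite {1}NS; apply: smallest_sub; first exact: flat_module_submodule.
move=> z Sz; have [a [x zE]] := SE z Sz.
apply: sub_gen_smallest; exists a, x; split=> //.
by apply/(flat_ofP _ _ NP); rewrite -zE NS; exact: sub_gen_smallest.
Qed.

Lemma flat_module_fin_generated F : is_flat v F -> fin_generated_flat v F ->
  fin_generated v (flat_module F).
Proof.
move=> FP [S Sfin FS].
have [lift liftP] := choice v_surj.
(* One vector is lifted per generating class, and [mzero] goes to 0. *)
pose gen (u : Mhat R E) : V :=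
  if u is Some (r, x) then lift (rmax_fin r) *: val x else 0.
exists (gen @` S); first exact: finite_image.
have NP : is_submodule v (smallest (is_submodule v (V := V)) (gen @` S)).
  exact: smallest_submodule.
apply/seteqP; split.
- apply: smallest_sub => // _ [a [x [Fa ->]]].
  (* The flat of the span of the lifts contains [S], hence contains the smallest such flat [F]. *)
  apply/(flat_ofP _ _ NP); move: (mcls _ _) Fa; rewrite {1}FS.
  apply: smallest_sub; first exact: flat_of_flat.
  case=> [[r x']|] Su; last exact: flat_of_mzero.
  exists x', (lift (rmax_fin r)); split; last by rewrite liftP.
  by apply: sub_gen_smallest; exists (Some (r, x')).
- apply: smallest_sub; first exact: flat_module_submodule.
  move=> _ [[[r x]|] Su <-] /=; last by case: (flat_module_submodule F).
  apply: sub_gen_smallest; exists (lift (rmax_fin r)), x; split=> //.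
  by rewrite liftP FS; exact: sub_gen_smallest.
Qed.

End Flats.

(** * Assembly of the correspondence from the two mutually inverse maps *)

Theorem theoremB (R : realType) (K : fieldType) (v : K -> Rmax R)
    (v_valuation : is_valuation v)
    (v_surjective : forall r : Rmax R, exists a : K, v a = r)
    (V : lmodType K) (E : {fset V}) (E_nonempty : E != fset0) :
  [/\ (* (1) *)
      forall F : set (Mhat R E),
        is_flat v F <->
        exists N : set V, is_submodule v N /\ F = flat_of v E N,
      (* (2), for all flats *)
      forall F : set (Mhat R E), is_flat v F ->
        exists! N : set V,
          [/\ is_submodule v N, generated_by_multiples v E N &
              F = flat_of v E N],
      (* (2), for finitely generated flats *)
      forall F : set (Mhat R E), is_flat v F -> fin_generated_flat v F ->
        exists! N : set V,
          [/\ is_submodule v N, fin_generated v N,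
              generated_by_multiples v E N & F = flat_of v E N]
    & (* the one-to-one correspondence *)
      set_bij
        [set N : set V | is_submodule v N /\ generated_by_multiples v E N]
        [set F : set (Mhat R E) | is_flat v F]
        (flat_of v E)].
Proof.
split.
- move=> F; split=> [FP|[N [NP ->]]]; last exact: flat_of_flat.
  exists (flat_module v F); split; first exact: flat_module_submodule.
  by rewrite flat_of_flat_module.
- move=> F FP; exists (flat_module v F); split.
    split; [exact: flat_module_submodule|exact: flat_module_generated|].
    by rewrite flat_of_flat_module.
  by move=> N [NP Ngen ->]; exact: flat_module_of_flat.
- move=> F FP Ffin; exists (flat_module v F); split.
    split; [exact: flat_module_submodule|exact: flat_module_fin_generated|
            exact: flat_module_generated|by rewrite flat_of_flat_module].
  by move=> N [NP _ Ngen ->]; exact: flat_module_of_flat.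
- split.
  + by move=> N [NP _]; exact: flat_of_flat.
  + move=> N N' /set_mem[NP Ngen] /set_mem[NP' Ngen'] eqF.
    by rewrite -(flat_module_of_flat v_valuation NP Ngen) eqF flat_module_of_flat.
  + move=> F /= FP; exists (flat_module v F); last exact: flat_of_flat_module.
    by split; [exact: flat_module_submodule|exact: flat_module_generated].
Qed.
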